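(* Let $G(N,S_N,f)$ and $G(M,S_M,g)$ be an $n$-person and an $m$-person non-cooperative strategic game ($n,m>1$), where each strategy set $S_i$ ($i\in N$) is a nonempty closed convex subset of a Banach space $B_i$ and each $S_j$ ($j\in M$) is a nonempty closed convex subset of a Banach space $B_j$. Let $A:B_N\to B_M$ be a continuous linear operator with $AS_N\subseteq S_M$, where $B_N=\prod_{i\in N}B_i$, $B_M=\prod_{j\in M}B_j$. Suppose: (a1) all $f_i$ and all $g_j$ are continuous and concave; (a2) $AS_N=S_M$; (a3) $A$ is convexity direction preserved with respect to $f$ and $g$ on $S_N$ and $S_M$. If there is a point $t\in S_N$ such that the set $$\{(z,Az)\in S_N\times S_M:\ F(t,z)\le^n f(z)\ \text{and}\ G(At,Az)\le^m g(Az)\}$$ is compact, then the split Nash equilibrium problem $\mathrm{SNE}(G(N,S_N,f),G(M,S_M,g),A)$ has a solution, i.e. there exists $\hat x\in S_N$ which is a Nash equilibrium of $G(N,S_N,f)$ such that $A\hat x$ is a Nash equilibrium of $G(M,S_M,g)$.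
   Context: An $n$-person non-cooperative strategic game $G(N,S_N,f)$ consists of a player set $N$ with $|N|=n$, strategy sets $S_i$, profile set $S_N=\prod_{i\in N}S_i$, and utility functions $f_i:S_N\to\mathbb R$, $f=\prod_i f_i:S_N\to\mathbb R^n$; write $x=(x_i,x_{-i})$ with $x_{-i}$ the strategies of players other than $i$. Define $F:S_N\times S_N\to\mathbb R^n$ by $F(z,x)=\prod_{i\in N}f_i(z_i,x_{-i})$ (so the $i$-th coordinate is $f_i(z_i,x_{-i})$). Analogously for $G(M,S_M,g)$, $G(w,y)=\prod_{j\in M}g_j(w_j,y_{-j})$. $\le^n$ denotes the componentwise order on $\mathbb R^n$. A profile $\hat x\in S_N$ is a Nash equilibrium of $G(N,S_N,f)$ if $F(z,\hat x)\le^n f(\hat x)$ for all $z\in S_N$, i.e. $f_i(z_i,\hat x_{-i})\le f_i(\hat x)$ for all $i$ and all $z_i\in S_i$. For $y\in B_M$, $y_j$ denotes its $j$-th component. The linear operator $A$ is called convexity direction preserved with respect to $f$ and $g$ on $S_N$ and $S_M$ (with $f_i,g_j$ concave) if for any $u,v\in S_N$ and any $w=\lambda u+(1-\lambda)v$ with $0\le\lambda\le1$, either both $F(u,w)\le^n f(w)$ and $G(Au,Aw)\le^m g(Aw)$ hold, or both $F(v,w)\le^n f(w)$ and $G(Av,Aw)\le^m g(Aw)$ hold. *)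

(* Defs.v *)
From HB Require Import structures.
From mathcomp Require Import all_boot all_order all_algebra.
From mathcomp Require Import all_classical all_reals all_analysis.
Set Implicit Arguments. Unset Strict Implicit. Unset Printing Implicit Defensive.
Import Order.TTheory GRing.Theory Num.Theory.
Import numFieldNormedType.Exports.
Local Open Scope classical_set_scope.
Local Open Scope ring_scope.

(* Profiles: x : forall i : 'I_n, B i  (B_N = prod_i B_i, with the product
   topology, which for finitely many normed spaces is the norm topology). *)

Section Defs.
Variable R : realType.

Variable n : nat.
Variable B : 'I_n -> normedModType R.

Definition padd (x y : forall i, B i) : forall i, B i := fun i => x i + y i.
Definition pscale (a : R) (x : forall i, B i) : forall i, B i :=
  fun i => a *: x i.
Definition pconv (l : R) (u v : forall i, B i) : forall i, B i :=
  fun i => l *: u i + (1 - l) *: v i.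

Definition profiles (S : forall i, set (B i)) : set (forall i, B i) :=
  [set x | forall i, S i (x i)].

Definition mixp (i : 'I_n) (z x : forall i, B i) : forall j, B j :=
  fun j => if j == i then z j else x j.

Definition Fle (f : 'I_n -> (forall i, B i) -> R) (z x : forall i, B i) : Prop :=
  forall i, f i (mixp i z x) <= f i x.

Definition nash_eq (S : forall i, set (B i)) (f : 'I_n -> (forall i, B i) -> R)
  (xh : forall i, B i) : Prop :=
  profiles S xh /\ forall z, profiles S z -> Fle f z xh.

Definition concave_on (S : set (forall i, B i)) (h : (forall i, B i) -> R) : Prop :=
  forall u v, S u -> S v -> forall l : R, 0 <= l <= 1 ->
    l * h u + (1 - l) * h v <= h (pconv l u v).

End Defs.

Definition plinear (R : realType) (n m : nat) (BN : 'I_n -> normedModType R)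
  (BM : 'I_m -> normedModType R) (A : (forall i, BN i) -> (forall j, BM j)) : Prop :=
  (forall x y, A (padd x y) = padd (A x) (A y)) /\
  (forall (a : R) x, A (pscale a x) = pscale a (A x)).

Definition conv_dir_preserved (R : realType) (n m : nat)
  (BN : 'I_n -> normedModType R) (BM : 'I_m -> normedModType R)
  (SN : forall i, set (BN i)) (f : 'I_n -> (forall i, BN i) -> R)
  (g : 'I_m -> (forall j, BM j) -> R) (A : (forall i, BN i) -> (forall j, BM j)) : Prop :=
  forall u v, profiles SN u -> profiles SN v -> forall l : R, 0 <= l <= 1 ->
    let w := pconv l u v in
    (Fle f u w /\ Fle g (A u) (A w)) \/ (Fle f v w /\ Fle g (A v) (A w)).

(* Main.v *)
(** Let [C u] be the closed set of profiles [w] at which replacing coordinates of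
    [w] by those of [u] improves no player of either game. A common point of all
    [C u] is a solution, and [C t] is compact, so finitely many [C u] have to be
    treated; for these KKM applies once every convex combination [w] of the [u a]
    lies in some [C (u a)] with positive weight. Condition (a3) says this only for
    two points, but it can be bootstrapped: if two players of the same game could
    improve at [w], exchanging coordinates yields a segment through [w] violating
    (a3) (for the second game, a segment in [SM], which lifts because [A] is onto).
    So at most one player of each game improves; concavity lets one average the
    [u a] over the two classes, and (a3) for the two averages is contradicted.
    KKM itself is derived from Scarf's lemma on dominant sets, whose parity
    argument needs no triangulation of the simplex. *)
Require Import Defs.
From mathcomp Require Import all_boot all_order all_algebra.
Set Implicit Arguments. Unset Strict Implicit. Unset Printing Implicit Defensive.

(** * Scarf's lemma *)

Section Scarf.
Variables (Y I : finType) (r : I -> Y -> nat) (s : I -> Y) (c : Y -> I).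
Hypothesis r_inj : forall i, injective (r i).
Hypothesis cardI : 1 < #|I|.
Hypothesis s_inj : injective s.
Hypothesis s_min : forall i y, r i (s i) <= r i y.
Hypothesis s_large : forall i j y, j != i -> y \notin s @: I -> r i y < r i (s j).
Hypothesis c_s : forall i, c (s i) = i.

(** Scarf's dominance: no [y] lies strictly above the minima of [T] in all orders at once, each
    minimum being taken in its own order. Dominant sets with [#|I|] elements are the rooms of the
    parity argument, sets with one element less its doors. *)
Definition dominant (T : {set Y}) :=
  [forall y, exists i, forall x in T, r i y <= r i x].

Lemma dominantP (T : {set Y}) :
  reflect (forall y, exists i, forall x, x \in T -> r i y <= r i x) (dominant T).
Proof.
apply: (iffP forallP) => H y; have := H y.
  by move=> /existsP[i /forall_inP Hi]; exists i.
by move=> [i Hi]; apply/existsP; exists i; apply/forall_inP.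
Qed.

Lemma dominantS (T U : {set Y}) : T \subset U -> dominant U -> dominant T.
Proof.
move=> /subsetP TU /dominantP H; apply/dominantP => y.
by have [i Hi] := H y; exists i => x /TU /Hi.
Qed.

Definition completions (T : {set Y}) :=
  [set y | (y \notin T) && dominant (y |: T)].

Definition beyond (m : I -> Y) k := [set y | [forall (l | l != k), r l (m l) < r l y]].

Lemma beyondP m k y :
  reflect (forall l, l != k -> r l (m l) < r l y) (y \in beyond m k).
Proof. by rewrite inE; apply: (iffP forall_inP). Qed.

Definition maximal_in k (M : {set Y}) := [set y in M | [forall z in M, r k z <= r k y]].

Lemma card_maximal_in k (M : {set Y}) : #|maximal_in k M| = (M != set0).
Proof.
case: (set_0Vmem M) => [->|[y0 My0]].
  by rewrite eqxx; apply/eqP; rewrite cards_eq0; apply/eqP/setP => z; rewrite !inE.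
have -> : M != set0 by apply/set0Pn; exists y0.
have [y My ymax] := (@arg_maxnP _ y0 [in M] (r k) My0).
apply/eqP/cards1P; exists y; apply/setP => z; rewrite !inE.
apply/andP/eqP => [[Mz /forall_inP zmax]|->]; last first.
  by split=> //; apply/forall_inP => x Mx; exact: ymax.
by apply: (@r_inj k); apply/eqP; rewrite eqn_leq zmax ?andbT //; exact: ymax.
Qed.

(* [m i] is the [i]-smallest element of [T]; domination makes [m] onto [T],
   so exactly one pair of orders shares its minimum. *)
Lemma door_pair (T : {set Y}) (m : I -> Y) : #|T|.+1 = #|I| -> dominant T ->
  (forall i, m i \in T) -> (forall i x, x \in T -> r i (m i) <= r i x) ->
  exists i j, [/\ i != j, m i = m j &
    #|completions T| = (beyond m i != set0) + (beyond m j != set0)].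
Proof.
move=> cT domT mT mmin.
have mE i x : x \in T -> (forall z, z \in T -> r i x <= r i z) -> m i = x.
  move=> xT Hx; apply: (@r_inj i); apply/eqP.
  by rewrite eqn_leq mmin //= Hx.
have nI : ~~ injectiveb m.
  apply/negP => /injectiveP /card_imset cm.
  have : m @: I \subset T by apply/subsetP => _ /imsetP[i _ ->].
  by move/subset_leq_card; rewrite cm -cT ltnn.
have /existsP[i /existsP[j /andP[ij /eqP mij]]] :
    [exists i, exists j, (i != j) && (m i == m j)].
  apply: contraR nI => /existsPn H; apply/injectiveP => i j mij.
  by apply/eqP; move: (H i) => /existsPn /(_ j); rewrite mij eqxx andbT negbK.
exists i, j; split=> //.
have onto_inj k : (forall x, x \in T -> exists2 l, l != k & m l = x) ->
    {in [set~ k] &, injective m}.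
  move=> H; apply/imset_injP; rewrite cardsC1 -cT /= eqn_leq.
  apply/andP; split; first by rewrite (leq_trans (leq_imset_card _ _)) // cardsC1 -cT.
  apply: subset_leq_card; apply/subsetP => x /H[l lk <-].
  by apply: imset_f; rewrite !inE.
have domM k y : (forall l, l != k -> r l (m l) < r l y) ->
    forall x, x \in T -> r k y <= r k x.
  move=> Hy; have /dominantP/(_ y)[l Hl] := domT.
  case: (eqVneq l k) => [<- //|lk].
  by have := Hy l lk; rewrite ltnNge Hl.
(* Adding the [k]-largest element of [beyond m k] keeps dominance: a competitor inside [beyond m k]
   is dominated through [k], any other through an order in which it fails to exceed [m]. The shared
   minimum keeps [y] out of [T]. *)
have fwd k k' y : k' != k -> m k = m k' -> y \in maximal_in k (beyond m k) ->
    y \in completions T.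
  move=> kk' mk; rewrite !inE => /andP[/forall_inP yM /forall_inP ymax].
  apply/andP; split.
    apply/negP => yT.
    have my : m k = y by apply: mE => //; apply: domM.
    by have := yM _ kk'; rewrite -mk my ltnn.
  apply/dominantP => z; case: (boolP (z \in beyond m k)) => zM.
    exists k => x; rewrite !inE => /orP[/eqP->|xT]; first exact: ymax.
    by apply: domM => //; apply/beyondP.
  move: zM; rewrite inE negb_forall => /existsP[l].
  rewrite negb_imply -leqNgt => /andP[lk zl]; exists l => x.
  rewrite !inE => /orP[/eqP->|xT]; first by rewrite (leq_trans zl) // ltnW // yM.
  by rewrite (leq_trans zl) // mmin.
have -> : completions T = maximal_in i (beyond m i) :|: maximal_in j (beyond m j).
  apply/setP => y; rewrite in_setU; apply/idP/orP => [|[]]; first last.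
  - by apply: (fwd j i).
  - by apply: (fwd i j) => //; rewrite eq_sym.
  rewrite inE => /andP[yT /dominantP domy].
  have neT l x : x \in T -> r l x <= r l y -> r l x < r l y.
    move=> xT; rewrite leq_eqVlt => /orP[/eqP/r_inj xy|//].
    by rewrite -xy xT in yT.
  (* Dominance tested at [y] itself gives the order [k] in which [y] is least. Each [x] in [T] is
     then a minimum in another order, so by cardinality [m] is injective off [k], and [m i = m j]
     forces [k] to be [i] or [j]. *)
  have [k Hk] := domy y.
  have yk x : x \in T -> r k y < r k x.
    move=> xT; rewrite ltn_neqAle Hk ?inE ?xT ?orbT // andbT.
    by apply: contraNneq yT => /r_inj->.
  have ontok x : x \in T -> exists2 l, l != k & m l = x /\ r l x <= r l y.
    move=> xT; have [l Hl] := domy x; exists l.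
      apply/eqP => lk; have := Hl y; rewrite setU11 lk => /(_ isT).
      by rewrite leqNgt yk.
    split; last by apply: Hl; rewrite setU11.
    by apply: mE => // z zT; apply: Hl; rewrite inE zT orbT.
  have injk : {in [set~ k] &, injective m}.
    by apply: onto_inj => x /ontok[l lk [? _]]; exists l.
  have yM : y \in beyond m k.
    apply/beyondP => l lk; apply: neT => //.
    have [l' l'k [ml' Hl']] := ontok _ (mT l).
    suff <- : l' = l by rewrite ml'.
    by apply: injk; rewrite ?inE.
  have ymax : y \in maximal_in k (beyond m k).
    rewrite inE yM; apply/forall_inP => z /beyondP zM.
    have [l Hl] := domy z; case: (eqVneq l k) => [<-|lk].
      by apply: Hl; rewrite setU11.
    by have := zM l lk; rewrite ltnNge Hl // inE mT orbT.
  have : (k == i) || (k == j).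
    apply: contraNT ij => /norP[ki kj]; apply/eqP.
    by apply: injk; rewrite // !inE eq_sym.
  by case/orP => /eqP <-; [left|right].
(* A common element of the two sets would exceed [m] in every order, against dominance of [T]; hence
   the cardinalities add. *)
rewrite cardsU !card_maximal_in.
rewrite (_ : _ :&: _ = set0) ?cards0 ?subn0 //.
apply/setP => y; rewrite in_set0; apply/negP; rewrite in_setI !(inE, in_setI).
move=> /andP[/andP[/forall_inP yi _] /andP[/forall_inP yj _]].
have /dominantP/(_ y)[l Hl] := domT.
case: (eqVneq l i) => [li|/yi]; last by rewrite ltnNge Hl.
by have := yj l; rewrite li ij => /(_ isT); rewrite ltnNge -li Hl.
Qed.

Lemma has_minima (T : {set Y}) : T != set0 ->
  exists m : I -> Y, (forall i, m i \in T) /\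
    (forall i x, x \in T -> r i (m i) <= r i x).
Proof.
case/set0Pn => t tT; exists (fun i => [arg min_(x < t in T) r i x]).
by split=> i; case: arg_minnP.
Qed.

(** A non-slack [x] in [T] lies below [s k] in every order other than [k], so [s k] belongs to
    [beyond m k] for both indices of the pair: a dominant [T] has two completions, any other [T]
    none. *)
Lemma even_completions (T : {set Y}) : #|T|.+1 = #|I| -> ~~ (T \subset s @: I) ->
  ~~ odd #|completions T|.
Proof.
move=> cT /subsetPn[x xT xs].
case: (boolP (dominant T)) => [domT|ndom]; last first.
  rewrite (_ : completions T = set0) ?cards0 //.
  apply/setP => y; rewrite !inE; apply/negbTE; rewrite negb_and orbC.
  by apply/orP; left; apply: contra ndom; apply: dominantS; rewrite subsetU1.
have [|m [mT mmin]] := @has_minima T; first by apply/set0Pn; exists x.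
have [i [j [_ _ ->]]] := door_pair cT domT mT mmin.
have ne k : beyond m k != set0.
  apply/set0Pn; exists (s k); apply/beyondP => l lk.
  by rewrite (leq_ltn_trans (mmin _ _ xT)) // s_large // eq_sym.
by rewrite !ne.
Qed.

(** The boundary door that makes the count odd. The shared minimum must involve [i0], since the
    other minima are the distinct [s l]; [beyond m i0] contains [s i0], while the set of the partner
    index is empty. *)
Lemma card_completions_slack i0 : #|completions (s @: [set~ i0])| = 1.
Proof.
set T := s @: _.
have inT l : l != i0 -> s l \in T by move=> ?; apply: imset_f; rewrite !inE.
have cT : #|T|.+1 = #|I|.
  by rewrite card_imset // cardsC1 prednK // ltnW.
have neT : T != set0 by rewrite -cards_eq0 -lt0n -ltnS cT.
have domT : dominant T.
  apply/dominantP => y; case: (boolP (y \in s @: I)) => [/imsetP[k _ ->]|yn].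
    by exists k => x _.
  exists i0 => x /imsetP[l]; rewrite !inE => li ->.
  by rewrite ltnW // s_large.
have [m [mT mmin]] := has_minima neT.
have mE l : l != i0 -> m l = s l.
  move=> li; apply: (@r_inj l); apply/eqP; rewrite eqn_leq s_min andbT.
  by rewrite mmin // inT.
have ne : beyond m i0 != set0.
  apply/set0Pn; exists (s i0); apply/beyondP => l li.
  rewrite mE // ltn_neqAle s_min andbT.
  by apply: contraNneq li => /r_inj/s_inj->.
have e0 j : j != i0 -> m i0 = m j -> beyond m j = set0.
  move=> ji mij; apply/setP => y; rewrite [RHS]inE; apply/negP => /beyondP H.
  have := H i0; rewrite eq_sym ji mij mE // => /(_ isT) Hy.
  case: (boolP (y \in s @: I)) => [/imsetP[l _ yl]|yn]; last first.
    by have := s_large ji yn; rewrite ltnNge ltnW.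
  case: (eqVneq l i0) => [li|li]; first by move: Hy; rewrite yl li ltnNge s_min.
  case: (eqVneq l j) => [lj|lj]; first by move: Hy; rewrite yl lj ltnn.
  by have := H _ lj; rewrite mE // yl ltnn.
have [i [j [ij mij ->]]] := door_pair cT domT mT mmin.
case: (eqVneq i i0) => [ii|ii].
  by rewrite ii ne (e0 j) ?eqxx //; rewrite -ii // eq_sym.
case: (eqVneq j i0) => [jj|jj].
  by rewrite jj ne (e0 i) ?eqxx // -jj.
by move: mij; rewrite !mE // => /s_inj /eqP; rewrite (negbTE ij).
Qed.

Definition good_door i0 (T : {set Y}) :=
  (#|T|.+1 == #|I|) && (c @: T == [set~ i0]).

(** If [R :\ x] is a good door and [R] lacks a colour, the colour of [x] is repeated by exactly one
    [x'], and the good doors of [R] arise by removing [x] or [x']. *)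
Lemma even_good_doors i0 (R : {set Y}) : #|R| = #|I| -> c @: R != setT ->
  ~~ odd #|[set x in R | good_door i0 (R :\ x)]|.
Proof.
move=> cR ncol.
set E := [set x in R | _].
have [->|[x]] := set_0Vmem E; first by rewrite cards0.
rewrite inE => /andP[xR /andP[_ /eqP cx]].
have DR z : z \in R -> #|R :\ z|.+1 = #|I| by move=> zR; rewrite -cR (cardsD1 z R) zR.
have injc z : z \in R -> c @: (R :\ z) = [set~ i0] -> {in R :\ z &, injective c}.
  by move=> zR cz; apply/imset_injP; rewrite cz cardsC1 -(DR z).
have cRE : c @: R = c x |: c @: (R :\ x).
  by rewrite -[in LHS](setD1K xR) imsetU1.
have cxi : c x \in [set~ i0].
  rewrite !inE; apply: contraNneq ncol => cxi.
  by apply/eqP; rewrite cRE cx cxi; apply/setP => z; rewrite !inE orbN.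
have /imsetP[x' x'D cxx'] : c x \in c @: (R :\ x) by rewrite cx.
have /andP[xx' x'R] : (x' != x) && (x' \in R) by move: x'D; rewrite !inE.
have cx' : c @: (R :\ x') = [set~ i0].
  rewrite -cx; apply/eqP; rewrite eqEsubset; apply/andP; split; apply/subsetP => y /imsetP[z];
  rewrite !inE => /andP[zn zR] ->.
    case: (eqVneq z x) => [->|zx]; first by rewrite cxx'; apply: imset_f.
    by apply: imset_f; rewrite !inE zx.
  case: (eqVneq z x') => [->|zx]; first by rewrite -cxx'; apply: imset_f; rewrite !inE eq_sym xx'.
  by apply: imset_f; rewrite !inE zx.
suff -> : E = [set x; x'] by rewrite cards2 eq_sym xx'.
apply/setP => z; rewrite !inE; apply/idP/idP => [/andP[zR /andP[_ /eqP cz]]|].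
  apply: contraNT xx' => /norP[zx zx']; apply/eqP.
  by apply: (injc _ zR cz) => //; rewrite !inE ?xR ?x'R eq_sym ?zx ?zx'.
by case/orP => /eqP ->; rewrite /good_door ?xR ?x'R DR // eqxx ?cx ?cx' eqxx.
Qed.

(** Double counting of the pairs of a room and a good door in it. If no room had all colours,
    counting by rooms would give an even number; counting by doors gives an odd one, because only
    the slack door has an odd number of completions. *)
Theorem scarf : exists R : {set Y}, [/\ dominant R, #|R| = #|I| & c @: R = setT].
Proof.
have /card_gt0P[i0 _] : 0 < #|I| by exact: ltnW.
case: (boolP [exists R : {set Y}, [&& dominant R, #|R| == #|I| & c @: R == setT]]).
  by move=> /existsP[R /and3P[? /eqP ? /eqP ?]]; exists R.
move=> /existsPn none; exfalso.
pose room R := dominant R && (#|R| == #|I|).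
have L : ~~ odd (\sum_(R | room R) #|[set x in R | good_door i0 (R :\ x)]|).
  apply: (big_ind (fun n => ~~ odd n)) => // [a b /negbTE ha /negbTE hb|R].
    by rewrite oddD ha hb.
  move=> /andP[dR /eqP cR]; apply: even_good_doors => //.
  by have := none R; rewrite dR cR eqxx.
suff : odd (\sum_(T | good_door i0 T) #|completions T|).
  apply/negP; congr (~~ odd _): L.
  under eq_bigr do rewrite -sum1_card.
  under [RHS]eq_bigr do rewrite -sum1_card.
  rewrite (exchange_big_dep predT) //= [RHS](exchange_big_dep predT) //=.
  apply: eq_bigr => x _.
  rewrite (reindex_onto (fun T => x |: T) (fun R => R :\ x)) /=; last first.
    by move=> R; rewrite inE => /andP[_ /andP[xR _]]; rewrite setD1K.
  apply: eq_bigl => T; rewrite !inE eqxx /=.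
  case: (boolP (x \in T)) => xT /=.
    rewrite [RHS]andbF; apply/negbTE; rewrite negb_and; apply/orP; right.
    by apply/eqP => TE; move: xT; rewrite -TE !inE eqxx.
  rewrite setU1K // eqxx andbT /room cardsU1 xT add1n /good_door.
  by case: (#|T|.+1 == _); rewrite ?andbF ?andbT //= andbC.
have g0 : good_door i0 (s @: [set~ i0]).
  rewrite /good_door card_imset // cardsC1 prednK ?eqxx; last exact: ltnW.
  rewrite -imset_comp; apply/eqP/setP => z; apply/imsetP/idP => [[k ki ->]|zi].
    by rewrite /= c_s.
  by exists z; rewrite //= c_s.
rewrite (bigD1 _ g0) /= card_completions_slack oddD /=.
apply: (big_ind (fun n => ~~ odd n)) => // [a b /negbTE ha /negbTE hb|T].
  by rewrite oddD ha hb.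
move=> /andP[/andP[/eqP cT /eqP cc] nT]; apply: even_completions => //.
(* A good door consisting of slack elements is determined by its colours, hence is the slack door
   already split off. *)
apply: contra nT => /subsetP Ts; rewrite eqEcard card_imset // cardsC1.
rewrite -cT leqnn andbT; apply/subsetP => x xT.
have /imsetP[k _ xk] := Ts _ xT; rewrite xk; apply: imset_f.
by rewrite -cc -(c_s k) -xk; apply: imset_f.
Qed.

End Scarf.

(** * Scarf's lemma on the integer grid of a simplex *)

Section GridLabelling.
Variables (I : finType) (N : nat) (c : {ffun I -> 'I_N.+1} -> I).
Hypothesis cardI : 1 < #|I|.

Let grid := {a : {ffun I -> 'I_N.+1} | \sum_i a i == N}.
Let base := #|{: grid}|.+1.

(** Grid points are ordered by coordinate [i], with the enumeration as tie-breaker, kept below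
    [base]. The successor puts every grid point above the slack element [i], of rank 0, and [N.+2]
    puts the other slack elements above all grid points. *)
Let rank i (y : grid + I) : nat :=
  match y with
  | inl a => (sval a i).+1 * base + enum_rank a
  | inr j => if j == i then 0 else N.+2 * base + enum_rank j
  end.

Let label (y : grid + I) : I := match y with inl a => c (sval a) | inr j => j end.

Let rank_mono i (a b : grid) : rank i (inl a) <= rank i (inl b) -> sval a i <= sval b i.
Proof.
rewrite /rank; apply: contraTT; rewrite -!ltnNge => ba.
have ra := ltn_ord (enum_rank b).
rewrite (@leq_trans ((sval b i).+2 * base)) //; last first.
  by rewrite (leq_trans _ (leq_addr _ _)) // leq_mul2r ltnS ba orbT.
by rewrite [X in _ < X]mulSn addnC ltn_add2r ltnS ltnW.
Qed.

Let rank_slack i (a : grid) j : j != i -> rank i (inl a) < rank i (inr j).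
Proof.
move=> /negbTE /= ->; rewrite (leq_trans _ (leq_addr _ _)) //.
have ra := ltn_ord (enum_rank a).
rewrite (@leq_trans ((sval a i).+2 * base)) //; last first.
  by rewrite leq_mul2r ltnS ltn_ord orbT.
by rewrite [X in _ < X]mulSn addnC ltn_add2r ltnS ltnW.
Qed.

Let rank_inj i : injective (rank i).
Proof.
move=> [a|j] [b|l] E.
- have : enum_rank a = enum_rank b.
    move: E => /= /(congr1 (modn^~ base)); rewrite !modnMDl !modn_small => [/val_inj//| |];
    by rewrite /base ltnS ltnW.
  by move/enum_rank_inj ->.
- case: (eqVneq l i) => [li|/(rank_slack a)]; last by rewrite E ltnn.
  by move: E; rewrite /= li eqxx.
- case: (eqVneq j i) => [li|/(rank_slack b)]; last by rewrite E ltnn.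
  by move: E; rewrite /= li eqxx.
- move: E => /=; case: eqVneq => [->|ji]; case: eqVneq => [->|li] //.
  by move/eqP; rewrite eqn_add2l => /eqP /val_inj /enum_rank_inj ->.
Qed.

(** The grid points of a set given by [scarf] are close together: dominance makes their
    coordinatewise minima [mu] add up to at least [N - #|I|], which confines them to within [#|I|]
    above [mu]. A colour supplied by a slack element has [mu i = 0], whence the first
    alternative. *)
Lemma grid_labelling : exists x : {ffun I -> 'I_N.+1}, \sum_i x i = N /\
  forall i, x i <= #|I| \/ exists x' : {ffun I -> 'I_N.+1}, [/\ \sum_i x' i = N, c x' = i &
    forall k, x' k <= x k + #|I| /\ x k <= x' k + #|I| ].
Proof.
have [R [/dominantP domR _ cR]] : exists R : {set grid + I},
    [/\ dominant rank R, #|R| = #|I| & label @: R = setT].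
  apply: (@scarf _ _ rank (@inr grid I)) => //.
  - by move=> i j [].
  - by move=> i y; rewrite /= eqxx.
  - move=> i j [a|l] ji; first by move=> _; exact: rank_slack.
    by case/negP; apply: imset_f.
have domX (a : grid) : exists2 i, inr i \notin R &
    forall b : grid, inl b \in R -> sval a i <= sval b i.
  have [i Hi] := domR (inl a); exists i.
    by apply/negP => /Hi; rewrite /= eqxx.
  by move=> b /Hi /rank_mono.
have lab i : inr i \notin R -> exists2 b : grid, inl b \in R & c (sval b) = i.
  move=> iR; have : i \in label @: R by rewrite cR.
  by case/imsetP => -[b bR ->|j jR ij]; [exists b|rewrite ij jR in iR].
have /card_gt0P[i0 _] : 0 < #|I| by exact: ltnW.
have mkgrid (h : I -> nat) : \sum_i h i = N -> exists a : grid, forall i, sval a i = h i :> nat.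
  move=> hN; have hle i : h i < N.+1 by rewrite ltnS -hN (bigD1 i) //= leq_addr.
  pose a := [ffun i => Ordinal (hle i)].
  have aN : \sum_i a i == N by apply/eqP; rewrite -[RHS]hN; apply: eq_bigr => i _; rewrite ffunE.
  by exists (exist _ a aN) => i; rewrite /= ffunE.
(* Dominance at any one grid point, here a corner, shows that some slack element is missing from
   [R]; its colour must come from a grid point [b0]. *)
have [a0 _] : exists a : grid, forall i, sval a i = (if i == i0 then N else 0) :> nat.
  by apply: mkgrid; rewrite -big_mkcond big_pred1_eq.
have [j0 j0R _] := domX a0.
have [b0 b0R _] := lab _ j0R.
pose mu i := if inr i \in R then 0
  else sval [arg min_(b < b0 | inl b \in R) sval b i] i : nat.
have mu_le (b : grid) i : inl b \in R -> mu i <= sval b i.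
  by move=> bR; rewrite /mu; case: ifP => // _; case: arg_minnP => // m _; apply.
have muN : N <= \sum_i mu i + #|I|.
  rewrite leqNgt; apply/negP => lt.
  have sS : \sum_i (mu i).+1 = \sum_i mu i + #|I|.
    by rewrite -sum1_card -big_split; apply: eq_bigr => i _ /=; rewrite addn1.
  (* If the minima were too small, some grid point would exceed [mu] in every coordinate, the
     surplus being put on [i0], and violate dominance. *)
  have [a aE] : exists a : grid, forall i, sval a i =
      (mu i).+1 + (if i == i0 then N - \sum_i (mu i).+1 else 0) :> nat.
    apply: mkgrid; rewrite big_split /= -[X in _ + X]big_mkcond big_pred1_eq subnKC //.
    by rewrite sS ltnW.
  have [i iR Hi] := domX a.
  have : sval a i <= mu i.
    by rewrite /mu (negbTE iR); case: arg_minnP => // m mR _; exact: Hi.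
  by rewrite aE addSn ltnNge leq_addr.
have le_mu (b : grid) i : inl b \in R -> sval b i <= mu i + #|I|.
  move=> bR; have /eqP sb := svalP b.
  have : \sum_i sval b i <= \sum_i mu i + #|I| by rewrite sb.
  rewrite (bigD1 i) //= [X in _ <= X + _](bigD1 i) //=.
  have : \sum_(l | l != i) mu l <= \sum_(l | l != i) sval b l.
    by apply: leq_sum => l _; exact: mu_le.
  by move=> H1 H2; rewrite -(leq_add2r (\sum_(l | l != i) mu l)) addnAC
    (leq_trans _ H2) // leq_add2l.
exists (sval b0); split; first exact/eqP/(svalP b0).
move=> i; case: (boolP (inr i \in R)) => iR.
  by left; have := le_mu _ i b0R; rewrite /mu iR.
right; have [b bR bi] := lab _ iR.
exists (sval b); split=> //; first exact/eqP/(svalP b).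
move=> k; split.
  by rewrite (leq_trans (le_mu _ k bR)) // leq_add2r mu_le.
by rewrite (leq_trans (le_mu _ k b0R)) // leq_add2r mu_le.
Qed.

End GridLabelling.

From mathcomp Require Import all_classical all_reals all_analysis.
From mathcomp Require Import ring lra.
Import Order.TTheory GRing.Theory Num.Theory.
Import numFieldNormedType.Exports.
Local Open Scope classical_set_scope.
Local Open Scope ring_scope.

(** * The KKM theorem *)

Section Simplex.
Variables (R : realType) (k : nat).

Definition simplex : set 'rV[R]_k :=
  [set x | (forall i, 0 <= x ord0 i) /\ \sum_i x ord0 i = 1].

Lemma simplex_le1 x i : simplex x -> x ord0 i <= 1.
Proof.
move=> [x0 <-]; rewrite (bigD1 i) //= lerDl.
by apply: sumr_ge0.
Qed.

Lemma closed_simplex : closed simplex.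
Proof.
have -> : simplex = \bigcap_(i in setT) [set x | 0 <= x ord0 i] `&`
    [set x | \sum_i x ord0 i = 1].
  by apply/seteqP; split=> x [x0 x1]; split=> // i; [move=> _; exact: x0|exact: (x0 i)].
have ci i : continuous (fun x : 'rV[R]_k => x ord0 i) by exact: coord_continuous.
apply: closedI.
  by apply: closed_bigI => i _; move/continuous_closedP: (ci i) => /(_ _ (@closed_ge _ 0)).
have /continuous_closedP/(_ _ (@closed_eq _ 1)) // :
    continuous (fun x : 'rV[R]_k => \sum_i x ord0 i).
by apply: continuous_big => //; exact: add_continuous.
Qed.

Lemma compact_simplex : compact simplex.
Proof.
apply: (subclosed_compact closed_simplex (rV_compact (fun i => segment_compact (a := 0) (b := 1)))).
move=> x xs i /=; rewrite in_itv /= simplex_le1 // andbT.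
by have [->] := xs.
Qed.

Lemma simplex_grid N (a : {ffun 'I_k -> 'I_N.+2}) : (\sum_i a i)%N = N.+1 ->
  simplex (\row_i ((a i)%:R / N.+1%:R)).
Proof.
move=> sa; split=> [i|]; first by rewrite mxE divr_ge0.
under eq_bigr do rewrite mxE.
by rewrite -mulr_suml -natr_sum sa divff // pnatr_eq0.
Qed.

Lemma simplex_approx_cover (L : 'I_k -> set 'rV[R]_k) (N : nat) : (1 < k)%N ->
  (forall x, simplex x -> exists i, L i x) ->
  exists2 x, simplex x & forall i, x ord0 i <= k%:R / N.+1%:R \/
    exists2 y, L i y & forall j, `|x ord0 j - y ord0 j| <= k%:R / N.+1%:R.
Proof.
move=> k1 cov.
pose pt (a : {ffun 'I_k -> 'I_N.+2}) : 'rV[R]_k := \row_i ((a i)%:R / N.+1%:R).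
(* Grid points are labelled by a set containing them; functions with another sum get an arbitrary
   label. *)
have /choice[c cP] (a : {ffun 'I_k -> 'I_N.+2}) :
    exists i, (\sum_i a i)%N = N.+1 -> L i (pt a).
  case: (eqVneq (\sum_i a i)%N N.+1) => [sa|/eqP sa].
    by have [i Li] := cov _ (simplex_grid sa); exists i.
  by exists (Ordinal (ltnW k1)).
have cI : (1 < #|'I_k|)%N by rewrite card_ord.
have [a [sa Ha]] := @grid_labelling _ _ c cI.
exists (pt a); first exact: simplex_grid.
have le_div (p q : nat) : (p <= q + k)%N -> p%:R / N.+1%:R - q%:R / N.+1%:R <= k%:R / N.+1%:R :> R.
  move=> pq; rewrite -mulrBl ler_pM2r ?invr_gt0 ?ltr0n //.
  by rewrite lerBlDl -natrD ler_nat.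
move=> i; have [|[b [sb cb Hb]]] := Ha i; [rewrite card_ord => ai|].
  by left; rewrite mxE ler_pM2r ?invr_gt0 ?ltr0n // ler_nat.
right; exists (pt b); first by rewrite -cb; exact: cP.
move=> j; have [] := Hb j; rewrite !card_ord !mxE => h1 h2.
rewrite ler_norml le_div // andbT lerNl opprB.
exact: le_div.
Qed.

(** The approximate solutions on grids of mesh [1 / N.+1] cluster by compactness, and closedness of
    the [L i] passes the property to a cluster point. *)
Lemma simplex_closed_cover (L : 'I_k -> set 'rV[R]_k) : (1 < k)%N ->
  (forall i, closed (L i)) -> (forall x, simplex x -> exists i, L i x) ->
  exists2 x, simplex x & forall i, x ord0 i = 0 \/ L i x.
Proof.
move=> k1 Lc cov.
have /choice[u uP] N : exists x, simplex x /\ forall i, x ord0 i <= k%:R / N.+1%:R \/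
    exists2 y, L i y & forall j, `|x ord0 j - y ord0 j| <= k%:R / N.+1%:R.
  by have [x] := simplex_approx_cover N k1 cov; exists x.
have [|x [xs xcl]] := @compact_simplex (u @ \oo) _.
  by exists 0%N => // N _; have [] := uP N.
have near_u e : 0 < e -> exists N, k%:R / N.+1%:R < e /\ forall j, `|x ord0 j - u N ord0 j| < e.
  move=> e0.
  have F1 : (u @ \oo) (u @` [set N | k%:R / N.+1%:R < e]).
    have e1 : 0 < e / k%:R by rewrite divr_gt0 // ltr0n ltnW.
    apply: filterS (near_infty_natSinv_lt (PosNum e1)) => N /= HN.
    exists N => //=; by rewrite -ltr_pdivlMl ?ltr0n ?(ltnW k1) // mulrC.
  have [y [[N HN <-] By]] := xcl _ (ball x e) F1 (nbhsx_ballx _ _ e0).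
  by exists N; split=> // j; have [_ /(_ ord0 j)] := By.
exists x => // i; case: (eqVneq (x ord0 i) 0) => [|xi]; [by left|right].
have {}xi : 0 < x ord0 i by rewrite lt_neqAle eq_sym xi; have [->] := xs.
apply: Lc => V /nbhs_ballP [e /= e0 eV].
(* The bound [e / 2] serves the triangle inequality. The bound [x ord0 i / 2] excludes the
   alternative of a small coordinate of [u N], which would give [x ord0 i < 2 * d]. *)
have [d [d0 de dx]] : exists d, [/\ 0 < d, d <= e / 2 & d <= x ord0 i / 2].
  exists (Num.min (e / 2) (x ord0 i / 2)).
  by rewrite lt_min !divr_gt0 // !ge_min !lexx orbT.
have [N [kN xu]] := near_u d d0.
have [_ /(_ i)[ui|[y Ly uy]]] := uP N.
  have h2 := le_lt_trans ui kN.
  by have := xu i; rewrite ltr_norml => /andP[_ h]; exfalso; lra.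
exists y; split => //; apply: eV; split=> // i' j; rewrite (ord1 i').
rewrite -ball_normE /= (_ : _ - _ = (x ord0 j - u N ord0 j) + (u N ord0 j - y ord0 j)); last by ring.
rewrite (le_lt_trans (ler_normD _ _)) // [e]splitr ltrD // (lt_le_trans _ de) //.
exact: le_lt_trans kN.
Qed.

End Simplex.

Lemma closed_within_le (R : realType) (T : topologicalType) (S : set T) (a b : T -> R) :
  closed S -> {within S, continuous a} -> {within S, continuous b} ->
  closed [set x | S x /\ a x <= b x].
Proof.
move=> Sc ac bc; have := within_continuousB bc ac => /continuous_closedP.
move=> /(_ _ (@closed_ge _ 0)) /closed_subspaceP [V Vc VE].
have -> : [set x | S x /\ a x <= b x] = V `&` S.
  rewrite VE; apply/seteqP; split => x [] /=; first by move=> Sx ab; split=> //=; rewrite subr_ge0.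
  by rewrite subr_ge0.
exact: closedI.
Qed.

(* Scarf labels a point by [i] when [d i x >= x_i * sum d]: at a point where each
   such inequality or [x_i = 0] holds, the total excess [sum d] has to vanish. *)
Lemma kkm (R : realType) (k : nat) (d : 'I_k -> 'rV[R]_k -> R) : (1 < k)%N ->
  (forall i, {within @simplex R k, continuous (d i)}) ->
  (forall i x, simplex x -> 0 <= d i x) ->
  (forall x, simplex x -> exists i, 0 < x ord0 i /\ d i x = 0) ->
  exists2 x, simplex x & forall i, d i x = 0.
Proof.
move=> k1 dc d0 cov.
pose D x := \sum_i d i x.
pose L i := [set x : 'rV[R]_k | simplex x /\ x ord0 i * D x <= d i x].
have [||x xs Lx] := @simplex_closed_cover R k L k1.
- move=> i; apply: closed_within_le => //; first exact: closed_simplex.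
  apply/subspace_continuousP => x xs; apply: cvgM.
    apply: cvg_within_filter; exact: coord_continuous.
  rewrite /D; apply: cvg_big => //; first exact: add_continuous.
  by move=> j _; move: (dc j) => /subspace_continuousP; apply.
- move=> x xs; apply/not_existsP => H.
  have : \sum_i d i x < \sum_i x ord0 i * D x.
    apply: ltr_sum; first by apply/hasP; exists (Ordinal (ltnW k1)).
    move=> i _; rewrite ltNge; apply/negP => le; apply: (H i); split=> //.
  by have [_ x1] := xs; rewrite -mulr_suml x1 mul1r ltxx.
(* At the index supplied by [cov] the weight is positive and [d i x = 0], so the label inequality
   forces [D x <= 0]. *)
exists x => //; have [i [xi di]] := cov x xs.
have D0 : D x <= 0.
  have [xi0|[_]] := Lx i; first by rewrite xi0 ltxx in xi.
  by rewrite di pmulr_rle0.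
move=> j; apply/eqP; rewrite eq_le d0 // andbT (le_trans _ D0) //.
by rewrite /D (bigD1 j) //= lerDl sumr_ge0 // => l _; exact: d0.
Qed.

(** * Convex combinations and improvements *)

Section Hulls.
Variables (R : realType) (n : nat) (B : 'I_n -> normedModType R).
Implicit Types (u v w : forall i, B i).

Definition pconv_closed (P : set (forall i, B i)) :=
  forall u v, P u -> P v -> forall l : R, 0 <= l <= 1 -> P (pconv l u v).

Lemma pconv_closed_seq (P : set (forall i, B i)) (I : eqType) (x : I -> R)
    (u : I -> forall i, B i) (a : I) (s : seq I) : pconv_closed P ->
  (forall b, b \in a :: s -> 0 < x b /\ P (u b)) ->
  P (fun i => (\sum_(b <- a :: s) x b)^-1 *: \sum_(b <- a :: s) x b *: u b i).
Proof.
move=> Pc; elim: s a => [|c s IH] a H.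
  have [xa Pa] := H a (mem_head _ _).
  congr (P _): Pa; apply: functional_extensionality_dep => i.
  by rewrite !big_seq1 scalerA mulVf ?scale1r // gt_eqF.
have [xa Pa] := H a (mem_head _ _).
have {}IH : P (fun i => (\sum_(b <- c :: s) x b)^-1 *: \sum_(b <- c :: s) x b *: u b i).
  by apply: IH => b bs; apply: H; rewrite inE bs orbT.
have s0 : 0 < \sum_(b <- c :: s) x b.
  rewrite big_cons ltr_pwDl //; first by have [] := H c; rewrite // !inE eqxx orbT.
  rewrite big_seq sumr_ge0 // => b bs; apply/ltW.
  by have [] := H b; rewrite // !inE bs !orbT.
set X := \sum_(b <- c :: s) x b in s0 IH.
have := Pc _ _ Pa IH (x a / (x a + X)).
have xX : 0 < x a + X by rewrite addr_gt0.
have -> : 0 <= x a / (x a + X) <= 1.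
  by rewrite divr_ge0 ?(ltW xa) ?(ltW xX) //= ler_pdivrMr // mul1r lerDl ltW.
move=> /(_ isT); congr (P _); apply: functional_extensionality_dep => i.
rewrite /pconv !(big_cons _ _ a) -/X scalerDr !scalerA; congr (_ + _).
  by rewrite mulrC.
congr (_ *: _); field.
by rewrite !gt_eqF.
Qed.

(** Membership in [P] is known only at positive weights, hence the restriction to the list [s] of
    such indices. Dividing by the total allows averaging over a single class of indices. *)
Lemma pconv_closed_sum (P : set (forall i, B i)) (I : finType) (Q : pred I) (x : I -> R)
    (u : I -> forall i, B i) : pconv_closed P -> (forall a, 0 <= x a) ->
  (forall a, Q a -> 0 < x a -> P (u a)) -> 0 < \sum_(a | Q a) x a ->
  P (fun i => (\sum_(a | Q a) x a)^-1 *: \sum_(a | Q a) x a *: u a i).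
Proof.
move=> Pc x0 PQ.
pose s := [seq a <- index_enum I | Q a && (0 < x a)].
have sE (V : lmodType R) (F : I -> V) :
    \sum_(a | Q a) x a *: F a = \sum_(a <- s) x a *: F a.
  rewrite big_filter [LHS]big_mkcond [RHS]big_mkcond; apply: eq_bigr => a _.
  case: (Q a) => //=; case: ltP => // xa.
  by rewrite (@le_anti _ _ (x a) 0) ?xa ?x0 // scale0r.
have sE1 : \sum_(a | Q a) x a = \sum_(a <- s) x a.
  transitivity (\sum_(a | Q a) x a *: (1 : R^o)).
    by apply: eq_bigr => a _; rewrite /GRing.scale /= mulr1.
  by rewrite sE; apply: eq_bigr => a _; rewrite /GRing.scale /= mulr1.
have -> : (fun i => (\sum_(a | Q a) x a)^-1 *: \sum_(a | Q a) x a *: u a i) =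
    (fun i => (\sum_(a <- s) x a)^-1 *: \sum_(a <- s) x a *: u a i).
  by apply: functional_extensionality_dep => i; rewrite sE1 sE.
rewrite sE1.
have : forall b, b \in s -> 0 < x b /\ P (u b).
  by move=> b; rewrite mem_filter => /andP[/andP[Qb xb] _]; split=> //; apply: PQ.
case: s {sE sE1} => [|a s] H; first by rewrite big_nil ltxx.
by move=> _; exact: pconv_closed_seq.
Qed.

Definition barycenter k (x : 'rV[R]_k) (u : 'I_k -> forall i, B i) : forall i, B i :=
  fun i => \sum_a x ord0 a *: u a i.

Lemma barycenter_in (P : set (forall i, B i)) k (x : 'rV[R]_k) (u : 'I_k -> forall i, B i) : pconv_closed P ->
  simplex x -> (forall a, 0 < x ord0 a -> P (u a)) -> P (barycenter x u).
Proof.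
move=> Pc [x0 x1] Pu.
have := @pconv_closed_sum P _ predT (fun a => x ord0 a) u Pc x0 (fun a _ => Pu a).
rewrite x1 => /(_ ltr01); congr (P _); apply: functional_extensionality_dep => i.
by rewrite invr1 scale1r.
Qed.

(** The points in [P1] and the remaining ones are averaged separately. Neither class has weight
    zero, as the barycenter would otherwise lie in the set of the other class. *)
Lemma barycenter_split (P1 P2 : set (forall i, B i)) k (x : 'rV[R]_k) (u : 'I_k -> forall i, B i) :
  pconv_closed P1 -> pconv_closed P2 -> simplex x ->
  (forall a, 0 < x ord0 a -> P1 (u a) \/ P2 (u a)) ->
  ~ P1 (barycenter x u) -> ~ P2 (barycenter x u) ->
  exists v1 v2 l, [/\ P1 v1, P2 v2, 0 < l < 1 & barycenter x u = pconv l v1 v2].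
Proof.
move=> P1c P2c xs Pu nP1 nP2; have [x0 x1] := xs.
pose Q a := `[< P1 (u a) >].
have [L1|L1] := ltP 0 (\sum_(a | Q a) x ord0 a); last first.
  case: nP2; apply: barycenter_in => // a xa.
  have [] := Pu a xa => // Pa; exfalso; move: L1; apply/negP; rewrite -ltNge.
  rewrite (bigD1 a) /=; last exact/asboolP.
  by rewrite ltr_pwDl // sumr_ge0.
have [L2|L2] := ltP 0 (\sum_(a | ~~ Q a) x ord0 a); last first.
  case: nP1; apply: barycenter_in => // a xa.
  apply: contrapT => nPa; move: L2; apply/negP; rewrite -ltNge.
  rewrite (bigD1 a) /=; last exact/asboolPn.
  by rewrite ltr_pwDl // sumr_ge0.
have L12 : \sum_(a | ~~ Q a) x ord0 a = 1 - \sum_(a | Q a) x ord0 a.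
  by move: x1; rewrite (bigID Q) /= => <-; rewrite addrAC subrr add0r.
have H1 := @pconv_closed_sum P1 _ Q (fun a => x ord0 a) u P1c x0.
have H2 := @pconv_closed_sum P2 _ (fun a => ~~ Q a) (fun a => x ord0 a) u P2c x0.
eexists; eexists; exists (\sum_(a | Q a) x ord0 a); split.
- by apply: H1 => // a /asboolP.
- by apply: H2 => // a /asboolPn nP1a xa; have [] := Pu a xa.
- by rewrite L1 /= -subr_gt0 -L12.
apply: functional_extensionality_dep => i; rewrite /pconv -L12 !scalerA.
by rewrite !divff ?gt_eqF // !scale1r /barycenter (bigID Q).
Qed.

(** Makes each [u a] of positive weight an endpoint of a segment through the barycenter, as
    [improver_unique] requires. The other endpoint averages the remaining points, or is [u a] again
    if these carry no weight. *)
Lemma barycenter_pconv (P : set (forall i, B i)) k (x : 'rV[R]_k) (u : 'I_k -> forall i, B i) a : pconv_closed P ->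
  simplex x -> (forall b, P (u b)) -> 0 < x ord0 a ->
  exists2 v, P v & barycenter x u = pconv (x ord0 a) (u a) v.
Proof.
move=> Pc xs Pu xa; have [x0 x1] := xs.
have L : \sum_(b | b != a) x ord0 b = 1 - x ord0 a.
  by move: x1; rewrite (bigD1 a) //= => <-; rewrite addrAC subrr add0r.
have E i : barycenter x u i = x ord0 a *: u a i + \sum_(b | b != a) x ord0 b *: u b i.
  by rewrite /barycenter (bigD1 a).
have [L0|L0] := ltP 0 (\sum_(b | b != a) x ord0 b).
  have := @pconv_closed_sum P _ (fun b => b != a) (fun b => x ord0 b) u Pc x0
    (fun b _ _ => Pu b) L0.
  move=> Pv; eexists; first exact: Pv.
  apply: functional_extensionality_dep => i.
  by rewrite E /pconv -L scalerA divff ?scale1r // gt_eqF.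
exists (u a) => //; apply: functional_extensionality_dep => i.
have z b : b != a -> x ord0 b = 0.
  move=> ba; apply/eqP; rewrite eq_le x0 andbT (le_trans _ L0) //.
  by rewrite (bigD1 b) //= lerDl sumr_ge0.
rewrite E /pconv -L big1 => [|b ba]; last by rewrite z // scale0r.
have -> : \sum_(b | b != a) x ord0 b = 0 by exact: big1.
by rewrite scale0r.
Qed.

End Hulls.

(** * Improving deviations of single players *)

Section Improvements.
Variables (R : realType) (n : nat) (B : 'I_n -> normedModType R).
Variables (S : forall i, set (B i)) (f : 'I_n -> (forall i, B i) -> R).
Hypothesis S_conv : forall i (u v : B i) (l : R), 0 <= l <= 1 -> @S i u -> @S i v ->
  @S i (l *: u + (1 - l) *: v).
Hypothesis f_conc : forall i, concave_on (profiles S) (f i).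
Implicit Types (u v w : forall i, B i).

Definition improves i u w := f i w < f i (mixp i u w).

Lemma not_FleP u w : ~ Fle f u w <-> exists i, improves i u w.
Proof.
split=> [/existsNP[i /negP]|[i ui] /(_ i)]; first by rewrite -ltNge; exists i.
by rewrite leNgt => /negP; apply.
Qed.

Lemma profiles_pconv : pconv_closed (profiles S).
Proof. by move=> u v Su Sv l l01 i; apply: S_conv. Qed.

Lemma profiles_mixp i u w : profiles S u -> profiles S w -> profiles S (mixp i u w).
Proof. by move=> Su Sw j; rewrite /mixp; case: ifP. Qed.

Lemma mixp_id i w : mixp i w w = w.
Proof. by apply: functional_extensionality_dep => j; rewrite /mixp; case: ifP. Qed.

Lemma improves_irr i w : ~ improves i w w.
Proof. by rewrite /improves mixp_id ltxx. Qed.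

Lemma eq_improves i u v w : u i = v i -> improves i u w -> improves i v w.
Proof.
move=> uv; rewrite /improves; congr (_ < f i _); apply: functional_extensionality_dep => j.
by rewrite /mixp; case: eqVneq => [->|].
Qed.

Lemma mixp_pconv i l u v w : mixp i (pconv l u v) w = pconv l (mixp i u w) (mixp i v w).
Proof.
apply: functional_extensionality_dep => j; rewrite /mixp /pconv; case: ifP => // _.
by rewrite -scalerDl addrC subrK scale1r.
Qed.

(** For fixed [w] the function [f i (mixp i u w)] is concave in the profile [u], so its strict upper
    level sets are convex. *)
Lemma improves_pconv i w : profiles S w ->
  pconv_closed [set u | profiles S u /\ improves i u w].
Proof.
move=> Sw u v [Su uw] [Sv vw] l l01; split; first exact: profiles_pconv.
rewrite /improves mixp_pconv.
apply: (lt_le_trans _ (@f_conc i _ _ (profiles_mixp i Su Sw) (profiles_mixp i Sv Sw) _ l01)).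
move: uw vw l01; rewrite /improves => uw vw /andP[l0 l1].
rewrite -subr_gt0.
have -> : l * f i (mixp i u w) + (1 - l) * f i (mixp i v w) - f i w =
  l * (f i (mixp i u w) - f i w) + (1 - l) * (f i (mixp i v w) - f i w) by ring.
move: l0; rewrite le_eqVlt => /orP[/eqP <-|l0].
  by rewrite mul0r add0r subr0 mul1r subr_gt0.
by rewrite ltr_pwDl ?mulr_gt0 ?mulr_ge0 ?subr_gt0 ?subr_ge0 // ltW.
Qed.

Lemma improves_shrink i u w l : profiles S u -> profiles S w -> 0 < l -> l <= 1 ->
  improves i u w -> improves i (pconv l u w) w.
Proof.
move=> Su Sw l0 l1; rewrite /improves mixp_pconv mixp_id => uw.
have l01 : 0 <= l <= 1 by rewrite ltW.
apply: (lt_le_trans _ (@f_conc i _ _ (profiles_mixp i Su Sw) Sw _ l01)).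
rewrite -subr_gt0.
have -> : l * f i (mixp i u w) + (1 - l) * f i w - f i w =
  l * (f i (mixp i u w) - f i w) by ring.
by rewrite mulr_gt0 // subr_gt0.
Qed.

(* If two players can improve at [w] along segments extending beyond [w], mix
   coordinates: one endpoint takes the move of [i], the other that of [j], each
   compensated by a step in the opposite direction at the other endpoint. *)
Lemma improver_unique i j u v u' v' w (a b : R) :
  (forall x y, profiles S x -> profiles S y -> forall l : R, 0 <= l <= 1 ->
    Fle f x (pconv l x y) \/ Fle f y (pconv l x y)) ->
  profiles S u -> profiles S v -> profiles S u' -> profiles S v' ->
  0 < a <= 1 -> 0 < b <= 1 -> w = pconv a u u' -> w = pconv b v v' ->
  improves i u w -> improves j v w -> i = j.
Proof.
move=> no2 Su Sv Su' Sv' /andP[a0 a1] /andP[b0 b1] wu wv uw vw.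
apply/eqP; apply/negPn/negP => ij.
have Sw : profiles S w by rewrite wu; apply: profiles_pconv; rewrite // (ltW a0).
have ab0 : 0 < a * b by rewrite mulr_gt0.
have ab1 : a * b <= 1 by rewrite mulr_ile1 // ltW.
(* In coordinate [i] the weights of [u] and [u'] are in the ratio [a : 1 - a], in coordinate [j]
   those of [v] and [v'] in the ratio [b : 1 - b]. The displacements of [U] and [V] from [w] are
   therefore opposite, and [w] is the midpoint. *)
pose U : forall k, B k := fun k => if k == i then pconv (a * b) u w k
  else if k == j then pconv (a * (1 - b)) v' w k else w k.
pose V : forall k, B k := fun k => if k == i then pconv (b * (1 - a)) u' w k
  else if k == j then pconv (a * b) v w k else w k.
have r01 (p q : R) : 0 < p -> p <= 1 -> 0 < q -> q <= 1 -> 0 <= p * (1 - q) <= 1.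
  move=> p0 p1 q0 q1; rewrite mulr_ge0 ?subr_ge0 ?(ltW p0) //=.
  by rewrite mulr_ile1 ?(ltW p0) ?subr_ge0 // gerBl ltW.
have ab01 : 0 <= a * b <= 1 by rewrite (ltW ab0).
have SU : profiles S U.
  by move=> k; rewrite /U; case: ifP => _; [|case: ifP => _ //]; apply: profiles_pconv => //; exact: r01.
have SV : profiles S V.
  by move=> k; rewrite /V; case: ifP => _; [|case: ifP => _ //]; apply: profiles_pconv => //; exact: r01.
have wE : w = pconv 2^-1 U V.
  apply: functional_extensionality_dep => k; rewrite /pconv /U /V.
  have half : 1 - 2^-1 = 2^-1 :> R by field.
  case: ifP => _; last case: ifP => _.
  - rewrite /pconv half -scalerDr.
    have -> : w k = a *: u k + (1 - a) *: u' k by rewrite wu.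
    set s := a *: u k + _.
    have -> : (a * b) *: u k + (1 - a * b) *: s + ((b * (1 - a)) *: u' k + (1 - b * (1 - a)) *: s)
      = b *: s + (2 - b) *: s.
      rewrite addrACA -scalerDl; congr (_ + _); last by congr (_ *: _); ring.
      by rewrite /s scalerDr !scalerA (mulrC b a).
    by rewrite -scalerDl addrC subrK scalerA mulVf ?scale1r // pnatr_eq0.
  - rewrite /pconv half -scalerDr.
    have -> : w k = b *: v k + (1 - b) *: v' k by rewrite wv.
    set s := b *: v k + _.
    have -> : (a * (1 - b)) *: v' k + (1 - a * (1 - b)) *: s + ((a * b) *: v k + (1 - a * b) *: s)
      = a *: s + (2 - a) *: s.
      rewrite addrACA -scalerDl; congr (_ + _); last by congr (_ *: _); ring.
      by rewrite /s scalerDr !scalerA addrC.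
    by rewrite -scalerDl addrC subrK scalerA mulVf ?scale1r // pnatr_eq0.
  - by rewrite -scalerDl addrC subrK scale1r.
have h01 : 0 <= (2^-1 : R) <= 1 by rewrite invr_ge0 ler0n invf_le1 ?ler1n.
have [] := no2 _ _ SU SV _ h01; rewrite -wE; apply/not_FleP.
  exists i; apply: eq_improves (improves_shrink Su Sw ab0 ab1 uw).
  by rewrite /U eqxx.
exists j; apply: eq_improves (improves_shrink Sv Sw ab0 ab1 vw).
by rewrite /V eq_sym (negbTE ij) eqxx.
Qed.

End Improvements.

(** * The covering condition for the two games together *)

Section SplitGame.
Variables (R : realType) (n m : nat).
Variables (BN : 'I_n -> normedModType R) (BM : 'I_m -> normedModType R).
Variables (SN : forall i, set (BN i)) (SM : forall j, set (BM j)).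
Variables (f : 'I_n -> (forall i, BN i) -> R) (g : 'I_m -> (forall j, BM j) -> R).
Variable A : (forall i, BN i) -> (forall j, BM j).
Hypothesis SN_conv : forall i (u v : BN i) (l : R), 0 <= l <= 1 ->
  @SN i u -> @SN i v -> @SN i (l *: u + (1 - l) *: v).
Hypothesis SM_conv : forall j (u v : BM j) (l : R), 0 <= l <= 1 ->
  @SM j u -> @SM j v -> @SM j (l *: u + (1 - l) *: v).
Hypothesis f_conc : forall i, concave_on (profiles SN) (f i).
Hypothesis g_conc : forall j, concave_on (profiles SM) (g j).
Hypothesis A_lin : plinear A.
Hypothesis A_onto : A @` profiles SN = profiles SM.
Hypothesis cdp : conv_dir_preserved SN f g A.

Lemma plinear_pconv l u v : A (pconv l u v) = pconv l (A u) (A v).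
Proof.
have [AD AZ] := A_lin.
have -> : pconv l u v = padd (pscale l u) (pscale (1 - l) v) by [].
by rewrite AD !AZ.
Qed.

Lemma profiles_image u : profiles SN u -> profiles SM (A u).
Proof. by rewrite -A_onto => Su; exists u. Qed.

(** This is the covering hypothesis of [kkm], obtained by extending [cdp] from two points to
    finitely many. *)
Lemma barycenter_cover k (x : 'rV[R]_k) (u : 'I_k -> forall i, BN i) :
  simplex x -> (forall a, profiles SN (u a)) ->
  exists a, [/\ 0 < x ord0 a, Fle f (u a) (barycenter x u) &
    Fle g (A (u a)) (A (barycenter x u))].
Proof.
move=> xs Su; apply: contrapT => /forallNP none.
set w := barycenter x u in none.
have SNc := profiles_pconv SN_conv.
have Sw : profiles SN w by apply: barycenter_in => // a _.
have SAw := profiles_image Sw.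
have split_at a : 0 < x ord0 a -> exists2 v, profiles SN v & w = pconv (x ord0 a) (u a) v.
  by move=> xa; exact: (barycenter_pconv SNc).
have xle a : 0 < x ord0 a -> 0 < x ord0 a <= 1 by move=> ->; rewrite simplex_le1.
have noN y z : profiles SN y -> profiles SN z -> forall l : R, 0 <= l <= 1 ->
    Fle f y (pconv l y z) \/ Fle f z (pconv l y z).
  by move=> Sy Sz l l01; have [[? _]|[? _]] := cdp Sy Sz l01; [left|right].
have noM y z : profiles SM y -> profiles SM z -> forall l : R, 0 <= l <= 1 ->
    Fle g y (pconv l y z) \/ Fle g z (pconv l y z).
  rewrite -A_onto => -[y' Sy <-] [z' Sz <-] l l01; rewrite -plinear_pconv.
  by have [[_ ?]|[_ ?]] := cdp Sy Sz l01; [left|right].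
pose posf i := exists2 a, 0 < x ord0 a & improves f i (u a) w.
pose posg j := exists2 a, 0 < x ord0 a & improves g j (A (u a)) (A w).
have posf_unique i i' : posf i -> posf i' -> i = i'.
  move=> [a xa ua] [b xb ub].
  have [a' Sa' wa] := split_at a xa; have [b' Sb' wb] := split_at b xb.
  exact: (improver_unique SN_conv f_conc noN (Su a) (Su b) Sa' Sb' (xle a xa) (xle b xb) wa wb ua ub).
have posg_unique j j' : posg j -> posg j' -> j = j'.
  move=> [a xa ua] [b xb ub].
  have [a' Sa' wa] := split_at a xa; have [b' Sb' wb] := split_at b xb.
  apply: (improver_unique SM_conv g_conc noM (profiles_image (Su a)) (profiles_image (Su b))
    (profiles_image Sa') (profiles_image Sb') (xle a xa) (xle b xb) _ _ ua ub).
    by rewrite -plinear_pconv -wa.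
  by rewrite -plinear_pconv -wb.
(* At most one player satisfies [posf], so all elements of [P1] improve the same player, which makes
   [P1] convex; likewise for [P2] and [posg]. *)
pose P1 := [set v | profiles SN v /\ exists2 i, posf i & improves f i v w].
pose P2 := [set v | profiles SN v /\ exists2 j, posg j & improves g j (A v) (A w)].
have P1c : pconv_closed P1.
  move=> y z [Sy [i pi yi]] [Sz [i' pi' zi]] l l01.
  rewrite (posf_unique _ _ pi' pi) in zi.
  have [Syz yzi] := improves_pconv SN_conv f_conc Sw (conj Sy yi) (conj Sz zi) l01.
  by split=> //; exists i.
have P2c : pconv_closed P2.
  move=> y z [Sy [j pj yj]] [Sz [j' pj' zj]] l l01.
  rewrite (posg_unique _ _ pj' pj) in zj.
  have [_ yzj] := improves_pconv SM_conv g_conc SAw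
    (conj (profiles_image Sy) yj) (conj (profiles_image Sz) zj) l01.
  by split; [exact: SNc | exists j; rewrite // plinear_pconv].
have cover a : 0 < x ord0 a -> P1 (u a) \/ P2 (u a).
  move=> xa; have [fa|/not_FleP[i ui]] := pselect (Fle f (u a) w); last first.
    by left; split=> //; exists i => //; exists a.
  have [ga|/not_FleP[j uj]] := pselect (Fle g (A (u a)) (A w)).
    by have := none a; case.
  by right; split=> //; exists j => //; exists a.
have nP1 : ~ P1 w by move=> [_ [i _ /improves_irr]].
have nP2 : ~ P2 w by move=> [_ [j _ /improves_irr]].
have [v1 [v2 [l [[S1 [i _ v1i]] [S2 [j _ v2j]] /andP[l0 l1] wE]]]] :=
  barycenter_split P1c P2c xs cover nP1 nP2.
have l01 : 0 <= l <= 1 by rewrite !ltW.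
(* [v1] improves a player of the first game and [v2] one of the second, so each alternative of [cdp]
   fails in one of its halves. *)
have [[+ _]|[_ +]] := cdp S1 S2 l01; rewrite -wE; apply/not_FleP; last by exists j.
by exists i.
Qed.

End SplitGame.

(** * Existence *)

Section Topology.
Variables (R : realType).

Lemma cvg_profile (n : nat) (B : 'I_n -> normedModType R) (T : Type) (F : set_system T)
    (h : T -> prod_topology B) (l : prod_topology B) : Filter F ->
  (forall i, h x i @[x --> F] --> l i) -> h @ F --> l.
Proof.
move=> FF hl; apply/cvg_sup => i U [_ [[V oV <-] Vl]] VU.
have FV : F [set x | V (h x i)] by apply: hl; exact: open_nbhs_nbhs.
suff : F [set x | U (h x)] by [].
by apply: filterS FV => x Vx; exact: VU.
Qed.

Lemma coordinate_continuous (n : nat) (B : 'I_n -> normedModType R) i :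
  continuous (fun x : prod_topology B => x i).
Proof. exact: (@proj_continuous 'I_n (fun i => B i) i). Qed.

Lemma within_continuous_compS (T U V : topologicalType) (S : set T) (S' : set U)
    (p : T -> U) (h : U -> V) : S `<=` p @^-1` S' ->
  {within S, continuous p} -> {within S', continuous h} -> {within S, continuous (h \o p)}.
Proof.
move=> SS' /subspace_continuousP pc /subspace_continuousP hc.
apply/subspace_continuousP => x Sx W /(hc _ (SS' _ Sx)) /= W'.
have PW : nbhs x [set y | S y -> S' (p y) -> W (h (p y))] by exact: (pc x Sx _ W').
suff : nbhs x [set y | S y -> W (h (p y))] by [].
by apply: filterS PW => y Wy Sy; apply: Wy => //; exact: SS'.
Qed.

Lemma closed_profiles (n : nat) (B : 'I_n -> normedModType R) (S : forall i, set (B i)) :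
  (forall i, closed (S i)) -> closed (profiles S : set (prod_topology B)).
Proof.
move=> Sc; have -> : profiles S = \bigcap_(i in setT) ((fun x => x i) @^-1` S i).
  by apply/seteqP; split=> x Sx i; [move=> _; exact: Sx|exact: (Sx i)].
apply: closed_bigI => i _.
by have /continuous_closedP := @coordinate_continuous n B i; apply.
Qed.

Lemma mixp_continuous (n : nat) (B : 'I_n -> normedModType R) i (u : forall i, B i) :
  continuous (mixp i u : prod_topology B -> prod_topology B).
Proof.
move=> x; apply: cvg_profile => [|j]; first exact: nbhs_filter.
rewrite /mixp; case: ifP => _; first exact: (@cst_continuous (prod_topology B) (B j) (u j) x).
exact: coordinate_continuous.
Qed.

Lemma barycenter_continuous (n : nat) (B : 'I_n -> normedModType R) k
    (u : 'I_k -> forall i, B i) :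
  continuous ((fun x : 'rV[R]_k => barycenter x u) : 'rV[R]_k -> prod_topology B).
Proof.
move=> x; apply: cvg_profile => [|i]; first exact: nbhs_filter.
have coordZ a : continuous (fun y : 'rV[R]_k => y ord0 a *: u a i).
  by move=> y; apply: cvgZr_tmp; [exact: (nbhs_filter y)|exact: coord_continuous].
by apply: continuous_big => //; exact: add_continuous.
Qed.

(** The total of the gains used by Nash. Truncation at 0 makes it nonnegative, with zeros exactly
    where no player gains, as needed for the functions [d] in [kkm]. *)
Definition excess (n : nat) (B : 'I_n -> normedModType R)
  (f : 'I_n -> (forall i, B i) -> R) (u w : forall i, B i) : R :=
  \sum_i Num.max 0 (f i (mixp i u w) - f i w).

Lemma excess_ge0 (n : nat) (B : 'I_n -> normedModType R)
  (f : 'I_n -> (forall i, B i) -> R) (u w : forall i, B i) : 0 <= excess f u w.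
Proof. by apply: sumr_ge0 => i _; rewrite le_max lexx. Qed.

Lemma excess_eq0 (n : nat) (B : 'I_n -> normedModType R)
  (f : 'I_n -> (forall i, B i) -> R) (u w : forall i, B i) :
  excess f u w = 0 <-> Fle f u w.
Proof.
split=> [/eqP|uw]; last first.
  by apply: big1 => i _; apply/max_idPl; rewrite subr_le0.
rewrite psumr_eq0 => [/allP h i|i _]; last by rewrite le_max lexx.
by have /eqP/max_idPl := h i (mem_index_enum i); rewrite subr_le0.
Qed.

Lemma excess_continuous (n : nat) (B : 'I_n -> normedModType R) (S : forall i, set (B i))
    (f : 'I_n -> (forall i, B i) -> R) (u : forall i, B i) :
  (forall i, {within (profiles S : set (prod_topology B)),
     continuous (f i : prod_topology B -> R)}) -> profiles S u ->
  {within (profiles S : set (prod_topology B)),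
     continuous (excess f u : prod_topology B -> R)}.
Proof.
move=> fc Su; apply: continuous_big => [|i _ x]; first exact: add_continuous.
apply: (@continuous_max R (subspace (profiles S : set (prod_topology B))) (fun=> 0)
  (fun w => f i (mixp i u w) - f i w) x); first exact: cst_continuous.
apply: cvgB; last exact: fc.
apply: (@within_continuous_compS _ _ _ _ (profiles S : set (prod_topology B))
  (mixp i u : prod_topology B -> prod_topology B) (f i)) => //.
- by move=> w Sw; exact: profiles_mixp.
- by apply: continuous_subspaceT; exact: mixp_continuous.
Qed.

End Topology.

(** The sets [B s] generate a proper filter containing [K]; closedness puts its cluster point into
    every [C i]. *)
Lemma compact_bigcap_closed (T : topologicalType) (K : set T) (I : choiceType) (D : set I)
    (C : I -> set T) : compact K -> (forall i, D i -> closed (C i)) ->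
  (forall s : seq I, (forall i, i \in s -> D i) -> exists2 x, K x & forall i, i \in s -> C i x) ->
  exists2 x, K x & forall i, D i -> C i x.
Proof.
move=> Kc Cc fin.
pose B (s : seq I) := [set x | K x /\ forall i, i \in s -> C i x].
pose Ds := [set s : seq I | forall i, i \in s -> D i].
pose F := filter_from Ds B.
have FF : ProperFilter F.
  apply: filter_from_proper; last by move=> s /fin [x Kx Cx]; exists x.
  apply: filter_from_filter; first by exists [::].
  move=> s s' sD sD'; exists (s ++ s').
    by move=> i; rewrite mem_cat => /orP[/sD|/sD'].
  move=> x [Kx Cx]; split; split=> // i si; apply: Cx; rewrite mem_cat si ?orbT //.
have FK : F K by exists [::] => // x [].
have [x [Kx xF]] := Kc F FF FK; exists x => // i Di.
apply: (Cc i Di) => V Vx; apply: xF => //.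
exists [:: i]; first by move=> j; rewrite inE => /eqP->.
by move=> y [_]; apply; rewrite inE.
Qed.

Lemma convex_set_comb (R : realType) (V : lmodType R) (S : set V) : convex_set S ->
  forall (u v : V) (l : R), 0 <= l <= 1 -> S u -> S v -> S (l *: u + (1 - l) *: v).
Proof.
move=> Sc u v l /andP[l0 l1] /mem_set Su /mem_set Sv.
by have /set_mem := Sc u v (Itv01 l0 l1) Su Sv.
Qed.

Unset Implicit Arguments. Set Strict Implicit.

Theorem theorem3p3 (R : realType) (n m : nat) (hn : (1 < n)%N) (hm : (1 < m)%N)
  (BN : 'I_n -> completeNormedModType R) (BM : 'I_m -> completeNormedModType R)
  (SN : forall i, set (BN i)) (SM : forall j, set (BM j))
  (f : 'I_n -> (forall i, BN i) -> R) (g : 'I_m -> (forall j, BM j) -> R)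
  (A : (forall i, BN i) -> (forall j, BM j)) :
  (forall i, SN i !=set0 /\ closed (SN i) /\ convex_set (SN i)) ->
  (forall j, SM j !=set0 /\ closed (SM j) /\ convex_set (SM j)) ->
  plinear A -> continuous (A : prod_topology BN -> prod_topology BM) ->
  A @` profiles SN `<=` profiles SM ->
  (* (a1) *)
  (forall i, {within (profiles SN : set (prod_topology BN)), continuous (f i : prod_topology BN -> R)} /\ concave_on (profiles SN) (f i)) ->
  (forall j, {within (profiles SM : set (prod_topology BM)), continuous (g j : prod_topology BM -> R)} /\ concave_on (profiles SM) (g j)) ->
  (* (a2) *)
  A @` profiles SN = profiles SM ->
  (* (a3) *)
  conv_dir_preserved SN f g A ->
  (exists t, profiles SN t /\
     compact [set zy : prod_topology BN * prod_topology BM |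
               exists z, [/\ profiles SN z, zy = (z, A z),
                             Fle f t z & Fle g (A t) (A z)]]) ->
  exists xh, nash_eq SN f xh /\ nash_eq SM g (A xh).
Proof.
move=> SNp SMp A_lin A_cont _ fp gp A_onto cdp [t [St Kc]].
have SN_conv i (u v : BN i) (l : R) : 0 <= l <= 1 -> SN i u -> SN i v ->
    SN i (l *: u + (1 - l) *: v).
  by apply: convex_set_comb; have [_ []] := SNp i.
have SM_conv j (u v : BM j) (l : R) : 0 <= l <= 1 -> SM j u -> SM j v ->
    SM j (l *: u + (1 - l) *: v).
  by apply: convex_set_comb; have [_ []] := SMp j.
have f_conc i : concave_on (profiles SN) (f i) by have [] := fp i.
have g_conc j : concave_on (profiles SM) (g j) by have [] := gp j.
have SAi u : profiles SN u -> profiles SM (A u) by exact: profiles_image.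
pose SNt : set (prod_topology BN) := profiles SN.
pose SMt : set (prod_topology BM) := profiles SM.
pose tot (u w : forall i, BN i) := excess f u w + excess g (A u) (A w).
have tot_ge0 u w : 0 <= tot u w by rewrite addr_ge0 // excess_ge0.
have tot_eq0 u w : tot u w = 0 <-> Fle f u w /\ Fle g (A u) (A w).
  rewrite -!excess_eq0 /tot; split=> [/eqP|[-> ->]]; last by rewrite addr0.
  by rewrite paddr_eq0 ?excess_ge0 // => /andP[/eqP ? /eqP ?].
have tot_cont u : profiles SN u -> {within SNt, continuous (tot u : prod_topology BN -> R)}.
  move=> Su x; apply: cvgD.
    by apply: excess_continuous => // i; have [] := fp i.
  apply: (@within_continuous_compS _ _ _ _ SMt (A : prod_topology BN -> prod_topology BM)
    (excess g (A u))).
  - by move=> w /SAi.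
  - exact: continuous_subspaceT.
  - by apply: excess_continuous; [move=> j; have [] := gp j|exact: SAi].
pose C (u : prod_topology BN) := [set w : prod_topology BN | SNt w /\ tot u w <= 0].
have CP u w : C u w <-> [/\ profiles SN w, Fle f u w & Fle g (A u) (A w)].
  split=> [[Sw tw]|[Sw fw gw]]; last by split; rewrite // (tot_eq0 u w).2.
  have [] : Fle f u w /\ Fle g (A u) (A w); last by [].
  by apply/tot_eq0/eqP; rewrite eq_le tw tot_ge0.
have C_closed u : SNt u -> closed (C u).
  move=> Su; apply: closed_within_le.
  - by apply: closed_profiles => i; have [_ []] := SNp i.
  - exact: tot_cont.
  - by move=> x; exact: cst_continuous.
(* The compact set of the hypothesis is the graph of [A] over [C t], and projects onto [C t]. *)
have Ct_compact : compact (C t).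
  have -> : C t = fst @` [set zy : prod_topology BN * prod_topology BM |
      exists z, [/\ profiles SN z, zy = (z, A z), Fle f t z & Fle g (A t) (A z)]].
    apply/seteqP; split=> [z /CP[Sz fz gz]|_ [_ [z [Sz -> fz gz]] <-]]; last exact/CP.
    by exists (z, A z) => //; exists z.
  apply: continuous_compact Kc; apply: continuous_subspaceT => x; exact: cvg_fst.
have fin (s : seq (prod_topology BN)) : (forall u, u \in s -> SNt u) ->
    exists2 w, C t w & forall u, u \in s -> C u w.
  (* Two copies of [t] are put in front of [s]: [kkm] asks for at least two vertices even if [s] is
     empty, and the point found must also lie in [C t]. *)
  move=> sS; pose k := (size s).+2.
  pose u (a : 'I_k) : prod_topology BN := nth t (t :: t :: s) a.
  have Su a : profiles SN (u a).
    have : u a \in t :: t :: s by apply: mem_nth; rewrite /= ltn_ord.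
    by rewrite !inE => /or3P[/eqP->|/eqP->|/sS].
  have Sb x : simplex x -> profiles SN (barycenter x u).
    by move=> xs; apply: (barycenter_in (profiles_pconv SN_conv)).
  have [a|a x _|x xs|x xs x0] := @kkm R k (fun a x => tot (u a) (barycenter x u)) isT.
  - apply: (@within_continuous_compS _ _ _ _ SNt (fun x => barycenter x u : prod_topology BN)
      (tot (u a))).
    + by move=> x; exact: Sb.
    + by apply: continuous_subspaceT; exact: barycenter_continuous.
    + exact: tot_cont.
  - exact: tot_ge0.
  - have [a [xa fa ga]] := barycenter_cover SN_conv SM_conv f_conc g_conc A_lin A_onto cdp xs Su.
    by exists a; split=> //; apply/tot_eq0.
  have Cx v : v \in t :: t :: s -> C v (barycenter x u).
    move=> vs; have vk : (index v (t :: t :: s) < k)%N by rewrite index_mem.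
    split; first exact: Sb.
    by have := x0 (Ordinal vk); rewrite /u nth_index // => ->.
  by exists (barycenter x u); [|move=> v vs]; apply: Cx; rewrite !inE ?eqxx ?vs ?orbT.
have [xh /CP[Sxh _ _] xhC] := compact_bigcap_closed Ct_compact C_closed fin.
exists xh; split; split=> //.
- by move=> z Sz; have /CP[] := xhC z Sz.
- exact: SAi.
(* Every deviation in the second game has the form [A z], and [xh] lies in [C z]. *)
- by rewrite -A_onto => _ [z Sz <-]; have /CP[] := xhC z Sz.
Qed.
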